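(* If $\xi,\eta\in \mathrm{c}_{\mathrm{o}}^*$ and $\xi\preccurlyeq\eta$, then $\xi=Q\eta$ for some orthostochastic matrix $Q$.
   Context: $\mathrm{c}_{\mathrm{o}}^*$ denotes the cone of nonnegative monotone nonincreasing sequences converging to $0$ (not a dual space). For $\xi,\eta\in \mathrm{c}_{\mathrm{o}}^*$: $\xi\prec\eta$ means $\sum_{j=1}^n\xi_j\le\sum_{j=1}^n\eta_j$ for every $n\in\mathbb N$; $\xi\preccurlyeq\eta$ (strong majorization) means $\xi\prec\eta$ and $\liminf_{n}\sum_{j=1}^n(\eta_j-\xi_j)=0$. An infinite matrix $Q=(Q_{ij})_{i,j\in\mathbb N}$ is orthostochastic if $Q_{ij}=(U_{ij})^2$ for all $i,j$, where $U$ is an orthogonal matrix, i.e., the matrix of a unitary operator on $\ell^2$ with real entries. $Q\eta$ is the sequence $\langle\sum_{j=1}^\infty Q_{ij}\eta_j\rangle_i$. *)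

(* Defs.v *)
From HB Require Import structures.
From mathcomp Require Import all_boot all_order all_algebra.
From mathcomp Require Import all_classical all_reals all_analysis.
From mathcomp Require Import complex.

Set Implicit Arguments.
Unset Strict Implicit.
Unset Printing Implicit Defensive.

Import Order.TTheory GRing.Theory Num.Theory.
Import numFieldNormedType.Exports.

Local Open Scope classical_set_scope.
Local Open Scope ring_scope.
Local Open Scope complex_scope.

Definition co_star (R : realType) (xi : nat -> R) : Prop :=
  [/\ forall n, 0 <= xi n, nonincreasing_seq xi & xi @ \oo --> 0].

Definition majorized (R : realType) (xi eta : nat -> R) : Prop :=
  forall n : nat, \sum_(j < n) xi j <= \sum_(j < n) eta j.

(* The liminf is taken in the extended reals: on [R] it would have a junk value
   when the partial sums tend to infinity. *)
Definition strongly_majorized (R : realType) (xi eta : nat -> R) : Prop :=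
  majorized xi eta /\
  limn_einf (fun n : nat => (\sum_(j < n) (eta j - xi j))%:E) = 0%E.

(* Complex l^2, carried by a set of sequences; the summand is the square modulus
   of [x n], as an element of [R]. The unqualified [Re] is [Num.Re], which takes
   values in [R[i]]. *)
Definition ell2 (R : realType) : set (nat -> R[i]) :=
  [set x : nat -> R[i] | cvgn (series (fun n =>
     complex.Re (x n) ^+ 2 + complex.Im (x n) ^+ 2 : R))].

(* Linear in the first argument; the series converges when x, y are in l^2.
   The cast to [R[i]^o] is needed for the topology of the modulus to be found. *)
Definition inner (R : realType) (x y : nat -> R[i]) : R[i] :=
  limn (series (fun n => x n * (y n)^* : R[i]^o)).

Definition std_basis (R : realType) (j : nat) : nat -> R[i] :=
  fun i => (i == j)%:R.

Definition unitary_op (R : realType) (T : (nat -> R[i]) -> (nat -> R[i])) :=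
  [/\ forall (a : R[i]) x y, ell2 x -> ell2 y ->
        T (fun n => a * x n + y n) = (fun n => a * T x n + T y n),
      forall x y, ell2 x -> ell2 y -> inner (T x) (T y) = inner x y
    & T @` @ell2 R = @ell2 R].

Definition orthogonal_matrix (R : realType) (U : nat -> nat -> R) : Prop :=
  exists2 T : (nat -> R[i]) -> (nat -> R[i]), unitary_op T &
    forall i j, inner (T (std_basis R j)) (std_basis R i) = (U i j)%:C.

Definition orthostochastic (R : realType) (Q : nat -> nat -> R) : Prop :=
  exists2 U : nat -> nat -> R, orthogonal_matrix U &
    forall i j, Q i j = U i j ^+ 2.

(* xi = Q eta, with convergence of each defining series part of the claim. *)
Definition is_matrix_image (R : realType) (Q : nat -> nat -> R)
    (eta xi : nat -> R) : Prop :=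
  forall i, series (fun j => Q i j * eta j) @ \oo --> xi i.

(* Main.v *)
(* The orthonormal rows f_0, f_1, ... of U are chosen greedily. At step k the
   compression of diag(eta) to the complement of f_0, ..., f_(k-1) is diagonal
   with nonincreasing entries eta^(k) in a finitely rotated basis; taking the
   least m with eta^(k)_(m+1) <= xi_k <= eta^(k)_m, a unit vector f_k in the
   plane of the m-th and (m+1)-st basis vectors has <diag(eta) f_k, f_k> = xi_k,
   and rotating that plane makes the next compression diagonal again. The tails
   of xi stay strongly majorized by eta^(k).
   Completeness: the partial sums satisfy S_p(k+1) <= S_(p+1)(k) - xi_k, so
   eta^(k)_0 <= eta_k + \sum_(j < k) (eta_j - xi_j), which is arbitrarily small
   by strong majorization. If x is orthogonal to all f_i then
   <diag(eta) x, x> <= eta^(k)_0 |x|^2 for all k, so x lives where eta vanishes;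
   following the coordinate of index l through the rotations, its index drops
   at each step until it is forced to be zero.
   Since the rows are finitely supported and complete, U and its transpose are
   mutually inverse contractions of l^2. *)
Require Import Defs.
From mathcomp Require Import all_boot all_order all_algebra.
From mathcomp Require Import all_classical all_reals all_analysis.
From mathcomp Require Import complex ring lra zify.

Import Order.TTheory GRing.Theory Num.Theory.
Import numFieldNormedType.Exports.

Local Open Scope classical_set_scope.
Local Open Scope ring_scope.
Local Open Scope complex_scope.

(* A rotation in the plane of the coordinates m, m+1 followed by the removal of
   one of the two: the surviving one gets the value v. *)
Definition collapse {R : realType} (m : nat) (v : R) (a : nat -> R) :
  nat -> R := fun l =>
    if (l < m)%N then a l else if l == m then v else a l.+1.

Lemma sum_collapse {R : realType} (m n : nat) (v : R) (a : nat -> R) :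
  (m < n)%N ->
  \sum_(l < n) collapse m v a l = \sum_(l < n.+1) a l - a m - a m.+1 + v.
Proof.
elim: n => // n IH; rewrite ltnS leq_eqVlt => /predU1P[->|mn].
  rewrite big_ord_recr /= !(big_ord_recr n.+1) (big_ord_recr n) /= /collapse.
  rewrite ltnn eqxx.
  under eq_bigr do rewrite ltn_ord.
  ring.
rewrite big_ord_recr /= IH// !(big_ord_recr n.+1) /= /collapse.
have -> : (n < m)%N = false by lia.
have -> : (n == m)%N = false by lia.
ring.
Qed.

Lemma sum_collapse_le {R : realType} (m n : nat) (v : R) (a : nat -> R) :
  (n <= m)%N -> \sum_(l < n) collapse m v a l = \sum_(l < n) a l.
Proof.
move=> nm; apply: eq_bigr => l _; rewrite /collapse.
by rewrite (leq_trans (ltn_ord l) nm).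
Qed.

(** * Square-summable real sequences *)

Definition sqsum_le {R : realType} (x : nat -> R) (B : R) : Prop :=
  forall n, \sum_(l < n) x l ^+ 2 <= B.

Lemma ler_sum_ord {R : realType} {u : nat -> R} {n p : nat} :
  (forall i, 0 <= u i) -> (n <= p)%N -> \sum_(l < n) u l <= \sum_(l < p) u l.
Proof.
move=> u0 /subnK <-; elim: (p - n)%N => // d IH.
by rewrite addSn big_ord_recr (le_trans IH) //= lerDl.
Qed.

Lemma ler_term_sum {R : realType} {u : nat -> R} {n l : nat} :
  (forall i, 0 <= u i) -> (l < n)%N -> u l <= \sum_(l < n) u l.
Proof.
move=> u0 ln; apply: le_trans _ (ler_sum_ord u0 ln).
by rewrite big_ord_recr /= lerDr sumr_ge0.
Qed.

Lemma bounded_series_cvg {R : realType} {u : nat -> R} {B : R} :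
  (forall i, 0 <= u i) -> (forall n, \sum_(l < n) u l <= B) -> cvgn (series u).
Proof.
move=> u0 uB; apply: nondecreasing_is_cvgn.
  by move=> n p np; rewrite seriesEord; exact: ler_sum_ord.
by exists B => _ [n _ <-]; rewrite seriesEord; exact: uB.
Qed.

Lemma sqsum_le_cvg {R : realType} {x : nat -> R} {B : R} : sqsum_le x B ->
  cvgn (series (fun l => x l ^+ 2)).
Proof. by move=> xB; apply: bounded_series_cvg xB => i; exact: sqr_ge0. Qed.

Lemma cvg_sqsum_le {R : realType} {x : nat -> R} :
  cvgn (series (fun l => x l ^+ 2)) ->
  sqsum_le x (limn (series (fun l => x l ^+ 2))).
Proof.
move=> cx n.
suff /nondecreasing_cvgn_le/(_ cx n) :
    nondecreasing_seq (series (fun l => x l ^+ 2)) by rewrite {1}seriesEord.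
move=> p q pq; rewrite seriesEord /=.
apply: (@ler_sum_ord _ (fun l => x l ^+ 2)) => // i; exact: sqr_ge0.
Qed.

Lemma sqsum_leD {R : realType} {x y : nat -> R} {B C : R} :
  sqsum_le x B -> sqsum_le y C ->
  sqsum_le (fun l => x l + y l) (2 * B + 2 * C).
Proof.
move=> xB yC n; apply: (@le_trans _ _
    (\sum_(l < n) (2 * x l ^+ 2 + 2 * y l ^+ 2))).
  apply: ler_sum => l _; have := sqr_ge0 (x l - y l); lra.
rewrite big_split /= -!mulr_sumr; have := xB n; have := yC n; lra.
Qed.

Lemma sqsum_leN {R : realType} {x : nat -> R} {B : R} :
  sqsum_le x B -> sqsum_le (fun l => - x l) B.
Proof. by move=> xB n; under eq_bigr do rewrite sqrrN; exact: xB. Qed.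

Lemma sqsum_le_delta {R : realType} (j : nat) :
  sqsum_le (fun l => (l == j)%:R : R) 1.
Proof.
move=> n; apply: (@le_trans _ _ (\sum_(l < n) (l == j :> nat)%:R)).
  by apply: ler_sum => l _; case: eqP; rewrite ?expr1n ?expr0n.
elim: n => [|n]; first by rewrite big_ord0.
case: (ltngtP n j) => [nj _|jn|-> _]; rewrite big_ord_recr /=.
- rewrite (ltn_eqF nj) addr0 big1// => l _.
  by rewrite (ltn_eqF (ltn_trans (ltn_ord l) nj)).
- by rewrite (gtn_eqF jn) addr0.
- rewrite eqxx big1 ?add0r// => l _; by rewrite (ltn_eqF (ltn_ord l)).
Qed.

(** * Successive plane rotations and the matrix [urow] they produce *)

Section rotations.
Context {R : realType} (m : nat -> nat) (c s : nat -> R).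
Hypothesis cs1 : forall k, c k ^+ 2 + s k ^+ 2 = 1.
Implicit Types (x y a b : nat -> R) (i j k l n : nat).

Definition pivot_coord k a := c k * a (m k) + s k * a (m k).+1.

Definition fwd k a := collapse (m k) (c k * a (m k).+1 - s k * a (m k)) a.

(** The coordinate at [m k] is placed along the unit vector [(- s k, c k)] of the plane, orthogonal
    to [pivot_vec k]. *)
Definition bwd k b : nat -> R := fun l =>
  if (l < m k)%N then b l
  else if l == m k then - s k * b (m k)
  else if l == (m k).+1 then c k * b (m k)
  else b l.-1.

Definition pivot_vec k : nat -> R := fun l =>
  if l == m k then c k else if l == (m k).+1 then s k else 0.

(* The coordinates of x in the rotated basis of the complement of the first k
   rows; fwd and bwd are adjoint to each other. *)
Fixpoint residual k x := if k is k'.+1 then fwd k' (residual k' x) else x.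

(** This is the matrix product U x, written recursively so that no series is involved; [rotate_dot]
    recovers the usual formula. *)
Definition rotate x k := pivot_coord k (residual k x).

Fixpoint bwd_iter k b := if k is k'.+1 then bwd_iter k' (bwd k' b) else b.

Definition urow i := bwd_iter i (pivot_vec i).

Lemma fwd_bwd k b : fwd k (bwd k b) = b.
Proof.
apply/funext => l; rewrite /fwd /bwd /collapse !ltnn !eqxx.
have -> : ((m k).+1 < m k)%N = false by lia.
have -> : ((m k).+1 == m k)%N = false by lia.
case: (ltngtP l (m k)) => [lm|lm|->] //.
  have -> : (l.+1 < m k)%N = false by lia.
  have -> : (l.+1 == m k)%N = false by lia.
  by have -> : (l.+1 == (m k).+1)%N = false by lia.
by rewrite -[RHS]mul1r -(cs1 k); ring.
Qed.

Lemma pivot_coord_bwd k b : pivot_coord k (bwd k b) = 0.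
Proof.
rewrite /pivot_coord /bwd !ltnn !eqxx.
have -> : ((m k).+1 < m k)%N = false by lia.
have -> : ((m k).+1 == m k)%N = false by lia.
ring.
Qed.

Lemma fwd_pivot_vec k : fwd k (pivot_vec k) = fun=> 0.
Proof.
apply/funext => l; rewrite /fwd /pivot_vec /collapse !eqxx.
have -> : ((m k).+1 == m k)%N = false by lia.
case: (ltngtP l (m k)) => [lm|lm|_].
- by have -> : (l == (m k).+1)%N = false by lia.
- have -> : (l.+1 == m k)%N = false by lia.
  by have -> : (l.+1 == (m k).+1)%N = false by lia.
- ring.
Qed.

Lemma pivot_coord_pivot_vec k : pivot_coord k (pivot_vec k) = 1.
Proof.
rewrite /pivot_coord /pivot_vec !eqxx.
have -> : ((m k).+1 == m k)%N = false by lia.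
by rewrite -(cs1 k); ring.
Qed.

Lemma residual_linear k (u v : R) x y :
  residual k (fun l => u * x l + v * y l) =
  (fun l => u * residual k x l + v * residual k y l).
Proof.
elim: k => //= k ->; apply/funext => l; rewrite /fwd /collapse.
by case: ifP => // _; case: ifP => // _; ring.
Qed.

Lemma rotate_linear (u v : R) x y k :
  rotate (fun l => u * x l + v * y l) k = u * rotate x k + v * rotate y k.
Proof. by rewrite /rotate residual_linear /pivot_coord; ring. Qed.

Lemma rotate0 k : rotate (fun=> 0) k = 0.
Proof.
have := @rotate_linear 0 0 (fun=> 0) (fun=> 0) k.
by rewrite !mul0r addr0.
Qed.

Lemma residual_bwd_iter k b : residual k (bwd_iter k b) = b.
Proof. by elim: k b => //= k IH b; rewrite IH fwd_bwd. Qed.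

Lemma rotate_bwd_iter k b i : (i < k)%N -> rotate (bwd_iter k b) i = 0.
Proof.
elim: k b => // k IH b; rewrite ltnS leq_eqVlt => /predU1P[->|ik].
  by rewrite /rotate /= residual_bwd_iter pivot_coord_bwd.
exact: IH.
Qed.

Lemma residual_urow i k : (i < k)%N -> residual k (urow i) = fun=> 0.
Proof.
elim: k => // k IH; rewrite ltnS leq_eqVlt => /predU1P[<-|ik] /=.
  by rewrite residual_bwd_iter fwd_pivot_vec.
rewrite IH//; apply/funext => l; rewrite /fwd /collapse !mulr0 subrr.
by case: ifP => // _; case: ifP.
Qed.

(** Orthonormality of the rows: before step i the row has no pivot component, at step i it is the
    unit pivot vector, and afterwards nothing is left of it. *)
Lemma rotate_urow i k : rotate (urow i) k = (k == i)%:R.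
Proof.
case: (ltngtP k i) => [ki|ik|->].
- exact: rotate_bwd_iter.
- by rewrite /rotate residual_urow// /pivot_coord !mulr0 addr0.
- by rewrite /rotate residual_bwd_iter pivot_coord_pivot_vec.
Qed.

(** Each step deletes one coordinate, hence the range [n + k], and extracts [d i] from the sum. The
    bound N ensures that every rotated plane lies inside the sums. *)
Lemma sum_telescope (w : nat -> nat -> R) (d : nat -> R) k :
  (forall i n, (m i < n)%N ->
    \sum_(l < n) w i.+1 l + d i = \sum_(l < n.+1) w i l) ->
  exists N, forall n, (N <= n)%N ->
    \sum_(l < n) w k l + \sum_(i < k) d i = \sum_(l < n + k) w 0 l.
Proof.
move=> wd; elim: k => [|k [N IH]].
  by exists 0 => n _; rewrite big_ord0 addr0 addn0.
exists (maxn N (m k).+1) => n; rewrite geq_max => /andP[Nn mn].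
rewrite addnS -addSn -IH ?(leqW Nn)// -(wd _ _ mn) big_ord_recr /=; ring.
Qed.

(** Pythagoras: each rotation preserves the square sum in its plane and moves one of the two new
    coordinates into [rotate x]. *)
Lemma energy x k : exists N, forall n, (N <= n)%N ->
  \sum_(l < n) residual k x l ^+ 2 + \sum_(i < k) rotate x i ^+ 2 =
  \sum_(l < n + k) x l ^+ 2.
Proof.
apply: (@sum_telescope (fun k l => residual k x l ^+ 2)
  (fun i => rotate x i ^+ 2)) => i n mn /=.
set a := residual i x.
have -> : \sum_(l < n) fwd i a l ^+ 2 =
    \sum_(l < n) collapse (m i) ((c i * a (m i).+1 - s i * a (m i)) ^+ 2)
      (fun l => a l ^+ 2) l.
  apply: eq_bigr => l _; rewrite /fwd /collapse.
  by case: ifP => // _; case: ifP.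
rewrite sum_collapse// /rotate -/a /pivot_coord.
set S := \sum_(l < n.+1) _.
have -> : a (m i) ^+ 2 = (c i ^+ 2 + s i ^+ 2) * a (m i) ^+ 2.
  by rewrite cs1 mul1r.
have -> : a (m i).+1 ^+ 2 = (c i ^+ 2 + s i ^+ 2) * a (m i).+1 ^+ 2.
  by rewrite cs1 mul1r.
ring.
Qed.

(** Adjointness of [fwd] and [bwd], iterated down from [pivot_vec i]. The bound N is uniform in [x]
    because the row is finitely supported. *)
Lemma rotate_dot i : exists N, forall x n, (N <= n)%N ->
  \sum_(l < n) x l * urow i l = rotate x i.
Proof.
have H k b : exists N, forall x n, (N <= n)%N ->
    \sum_(l < n + k) x l * bwd_iter k b l = \sum_(l < n) residual k x l * b l.
  elim: k b => [|k IH] b; first by exists 0 => x n _; rewrite addn0.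
  have [N HN] := IH (bwd k b).
  exists (maxn N (m k).+1) => x n; rewrite geq_max => /andP[Nn mn].
  rewrite addnS -addSn HN ?(leqW Nn)//=.
  set a := residual k x.
  pose v := (c k * a (m k).+1 - s k * a (m k)) * b (m k).
  have -> : \sum_(l < n) fwd k a l * b l =
      \sum_(l < n) collapse (m k) v (fun l => a l * bwd k b l) l.
    apply: eq_bigr => l _; rewrite /fwd /collapse /bwd.
    case: (ltngtP l (m k)) => [lm|lm|->] //.
    have -> : (l.+1 < m k)%N = false by lia.
    have -> : (l.+1 == m k)%N = false by lia.
    by have -> : (l.+1 == (m k).+1)%N = false by lia.
  rewrite sum_collapse// /v /bwd !ltnn !eqxx.
  have -> : ((m k).+1 < m k)%N = false by lia.
  have -> : ((m k).+1 == m k)%N = false by lia.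
  ring.
have [N HN] := H i (pivot_vec i).
exists ((maxn N (m i).+2) + i)%N => x n Nn.
have -> : n = (n - i + i)%N by lia.
rewrite HN ?/rotate; last by lia.
have : ((m i).+2 <= n - i)%N by lia.
elim: (n - i)%N => // p IH; rewrite leq_eqVlt => /predU1P[<-|mp].
  rewrite !big_ord_recr /= big1 => [|l _]; rewrite /pivot_vec /pivot_coord.
    rewrite !eqxx; have -> : ((m i).+1 == m i)%N = false by lia.
    ring.
  have lm := ltn_ord l.
  have -> : (l == m i :> nat) = false by lia.
  have -> : (l == (m i).+1 :> nat) = false by lia.
  ring.
rewrite big_ord_recr /= IH// /pivot_vec.
have -> : (p == m i :> nat) = false by lia.
have -> : (p == (m i).+1 :> nat) = false by lia.
ring.
Qed.

(** Bessel's inequality: the residual in [energy] is dropped. *)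
Lemma rotate_sqsum_le {x B} : sqsum_le x B -> sqsum_le (rotate x) B.
Proof.
move=> xB k; have [N /(_ N (leqnn N)) e] := energy x k.
rewrite (le_trans _ (xB (N + k)%N))// -e lerDr.
by apply: sumr_ge0 => l _; exact: sqr_ge0.
Qed.

Lemma sum_delta x j n : (j < n)%N ->
  \sum_(l < n) (l == j :> nat)%:R * x l = x j.
Proof.
move=> jn; rewrite (bigD1 (Ordinal jn))//= eqxx mul1r big1 ?addr0// => l lj.
have -> : (l == j :> nat) = false.
  by apply: contraNF lj => /eqP lj; apply/eqP/val_inj.
by rewrite mul0r.
Qed.

Lemma rotate_delta i j : rotate (fun l => (l == j)%:R) i = urow i j.
Proof.
have [N HN] := rotate_dot i.
by rewrite -(HN _ (maxn N j.+1)) ?leq_maxl// sum_delta// leq_maxr.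
Qed.

Definition synthesis y n : nat -> R := fun l => \sum_(i < n) y i * urow i l.

Lemma synthesisS y n :
  synthesis y n.+1 = (fun l => 1 * synthesis y n l + y n * urow n l).
Proof. by apply/funext => l; rewrite /synthesis big_ord_recr mul1r. Qed.

Lemma residual_synthesis y n k : (n <= k)%N ->
  residual k (synthesis y n) = fun=> 0.
Proof.
elim: n => [_|n IH nk].
  have -> : synthesis y 0 = (fun=> 0 * 0 + 0 * 0).
    by apply/funext => l; rewrite /synthesis big_ord0 !mul0r addr0.
  rewrite (residual_linear k 0 0 (fun=> 0) (fun=> 0)).
  by apply/funext => l; rewrite !mul0r addr0.
rewrite synthesisS residual_linear IH 1?ltnW// residual_urow//.
by apply/funext => l; rewrite !mulr0 addr0.
Qed.

Lemma rotate_synthesis y n i : rotate (synthesis y n) i = (i < n)%:R * y i.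
Proof.
elim: n => [|n IH].
  have -> : synthesis y 0 = (fun=> 0).
    by apply/funext => l; rewrite /synthesis big_ord0.
  by rewrite rotate0 mul0r.
rewrite synthesisS rotate_linear IH rotate_urow// (ltnS i n) (leq_eqVlt i n).
case: eqVneq => [->|_]; first by rewrite ltnn /= mul0r mulr0 add0r mulr1 mul1r.
by rewrite /= mulr0 addr0 mul1r.
Qed.

(** The residual vanishes after n steps, so [energy] becomes Parseval's identity for a finite
    combination of rows. *)
Lemma synthesis_sqsum_le {y B} n : sqsum_le y B -> sqsum_le (synthesis y n) B.
Proof.
move=> yB p; have [N HN] := energy (synthesis y n) n.
have := HN _ (leq_maxl N p); rewrite residual_synthesis//.
under eq_bigr do rewrite expr0n; rewrite big1// add0r => e.
apply: le_trans _ (yB n).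
have -> : \sum_(l < n) y l ^+ 2 = \sum_(i < n) rotate (synthesis y n) i ^+ 2.
  by apply: eq_bigr => i _; rewrite rotate_synthesis ltn_ord mul1r.
rewrite e; apply: (@ler_sum_ord _ (fun l => synthesis y n l ^+ 2)).
  by move=> i; exact: sqr_ge0.
by rewrite (leq_trans (leq_maxr N p))// leq_addr.
Qed.

(** The preimage is the transpose of U applied to [y], a coordinatewise limit of finite combinations
    of rows. *)
Lemma rotate_surjective {y B} : sqsum_le y B ->
  exists2 x, sqsum_le x B & rotate x = y.
Proof.
move=> yB.
(* Column l is the image of a basis vector, so its square sum is at most 1 by Bessel; absolute
   convergence with bound B + 1 follows from [|u v| <= u^2 + v^2]. *)
have cvg_x l : cvgn (series (fun i => y i * urow i l)).
  apply: normed_cvg; apply: (@bounded_series_cvg _ _ (B + 1)) => n.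
    exact: normr_ge0.
  have := rotate_sqsum_le (@sqsum_le_delta R l) n.
  under eq_bigr do rewrite rotate_delta.
  have := yB n => h1 h2; apply: le_trans _ (lerD h1 h2).
  rewrite -big_split; apply: ler_sum => i _ /=.
  rewrite normrM -(real_normK (num_real (y i))).
  rewrite -(real_normK (num_real (urow i l))).
  have := sqr_ge0 (`|y i| - `|urow i l|).
  have := mulr_ge0 (normr_ge0 (y i)) (normr_ge0 (urow i l)); lra.
pose x l := limn (series (fun i => y i * urow i l)).
have xP l : synthesis y n l @[n --> \oo] --> x l.
  by move: (cvg_x l); rewrite /x seriesEord.
exists x => [p|].
  apply: (@cvgr_to_le _ \oo _ _ (fun n => \sum_(l < p) synthesis y n l ^+ 2)).
    apply: cvg_big => [|l _]; first exact: add_continuous.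
    by apply: cvgM; exact: xP.
  by apply: nearW => n; exact: synthesis_sqsum_le.
apply/funext => i.
(* Row i has finite support, so coordinatewise convergence suffices to pass to the limit. *)
have [N HN] := rotate_dot i.
rewrite -(HN _ N)//.
have h1 : rotate (synthesis y n) i @[n --> \oo] --> \sum_(l < N) x l * urow i l.
  under eq_fun do rewrite -(HN _ N)//.
  apply: cvg_big => [|l _]; first exact: add_continuous.
  by apply: (cvgM (xP l)); exact: cvg_cst.
have h2 : rotate (synthesis y n) i @[n --> \oo] --> y i.
  apply: cvg_near_cst; near=> n; rewrite rotate_synthesis.
  suff -> : (i < n)%N by rewrite mul1r.
  by near: n; exact: nbhs_infty_gt.
have/cvg_lim <- // := h1; exact/cvg_lim.
Unshelve. all: by end_near. Qed.

(** * Isometry of [rotate] when the rows are complete *)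

Hypothesis rotate_ker0 : forall x B,
  sqsum_le x B -> (forall i, rotate x i = 0) -> forall l, x l = 0.

(** Surjectivity gives a preimage of [rotate x] with bound [B], and injectivity identifies it with
    [x]. *)
Lemma rotate_sqsum_ge {x A B} :
  sqsum_le x A -> sqsum_le (rotate x) B -> sqsum_le x B.
Proof.
move=> xA /rotate_surjective[z zB Tz].
suff -> : x = z by [].
apply/funext => l; apply/eqP; rewrite -subr_eq0; apply/eqP.
have := sqsum_leD xA (sqsum_leN zB) => /rotate_ker0; apply => i.
have -> : (fun l => x l + - z l) = (fun l => 1 * x l + (-1) * z l).
  by apply/funext => p; ring.
by rewrite rotate_linear -!/(rotate _ _) Tz; ring.
Qed.

Lemma rotate_norm {x B} : sqsum_le x B -> exists d : R,
  series (fun l => x l ^+ 2) @ \oo --> d /\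
  series (fun l => rotate x l ^+ 2) @ \oo --> d.
Proof.
move=> xB; have cx := sqsum_le_cvg xB.
have cT := sqsum_le_cvg (rotate_sqsum_le xB).
exists (limn (series (fun l => x l ^+ 2))); split=> //.
suff -> : limn (series (fun l => x l ^+ 2)) =
    limn (series (fun l => rotate x l ^+ 2)).
  by [].
have lim_le z (D : R) : sqsum_le z D -> cvgn (series (fun l => z l ^+ 2)) ->
    limn (series (fun l => z l ^+ 2)) <= D.
  move=> zD cz; apply: limr_le => //; apply: nearW => n.
  by rewrite seriesEord; exact: zD.
apply/le_anti/andP; split; apply: lim_le => //.
  by apply: rotate_sqsum_ge xB _; exact: cvg_sqsum_le.
by apply: rotate_sqsum_le; exact: cvg_sqsum_le.
Qed.

(** Polarization of [rotate_norm]. *)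
Lemma rotate_isometry {x y B C} : sqsum_le x B -> sqsum_le y C -> exists d : R,
  series (fun l => x l * y l) @ \oo --> d /\
  series (fun l => rotate x l * rotate y l) @ \oo --> d.
Proof.
move=> xB yC.
have [dx [x1 x2]] := rotate_norm xB.
have [dy [y1 y2]] := rotate_norm yC.
have [d [xy1 xy2]] := rotate_norm (sqsum_leD xB yC).
have polar (u v : nat -> R) : series (fun l => (u l + v l) ^+ 2) @ \oo --> d ->
    series (fun l => u l ^+ 2) @ \oo --> dx ->
    series (fun l => v l ^+ 2) @ \oo --> dy ->
    series (fun l => u l * v l) @ \oo --> 2^-1 * (d - dx - dy).
  move=> h1 h2 h3.
  have -> : series (fun l => u l * v l) = (fun n => 2^-1 *
     (series (fun l => (u l + v l) ^+ 2) n - series (fun l => u l ^+ 2) n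
       - series (fun l => v l ^+ 2) n)).
    apply/funext => n; rewrite !seriesEord /= -!sumrB mulr_sumr.
    by apply: eq_bigr => l _; field.
  by apply: cvgMl_tmp; apply: cvgB => //; exact: cvgB.
exists (2^-1 * (d - dx - dy)); split; apply: polar => //.
have -> : (fun l => (rotate x l + rotate y l) ^+ 2) =
    (fun l => rotate (fun l => x l + y l) l ^+ 2).
  apply/funext => l.
  have -> : (fun l => x l + y l) = (fun l => 1 * x l + 1 * y l).
    by apply/funext => p; rewrite !mul1r.
  by rewrite rotate_linear !mul1r.
exact: xy2.
Qed.

End rotations.

(** * The greedy choice of planes and angles *)

(** The invariant of the recursion. Smallness and strong majorization are put in a form with [e] and
    [N] that survives the index shift of each step. *)
Record admissible {R : realType} (xi eta : nat -> R) : Prop := Admissible {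
  adm_xi_ge0 : forall n, 0 <= xi n;
  adm_xi_mono : forall i j, (i <= j)%N -> xi j <= xi i;
  adm_eta_ge0 : forall n, 0 <= eta n;
  adm_eta_mono : forall i j, (i <= j)%N -> eta j <= eta i;
  adm_eta_small : forall e, 0 < e ->
    exists N, forall n, (N <= n)%N -> eta n < e;
  adm_maj : majorized xi eta;
  adm_gap : forall e N, 0 < e ->
    exists2 n, (N <= n)%N & \sum_(j < n) (eta j - xi j) < e }.

Arguments adm_xi_ge0 {R xi eta}.
Arguments adm_eta_ge0 {R xi eta}.
Arguments adm_eta_mono {R xi eta} _ {i j}.
Arguments adm_eta_small {R xi eta} _ {e}.
Arguments adm_gap {R xi eta} _ {e} N.

(** The unit vector [(c, s)] of the plane has diagonal value [x], and the strict inequality makes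
    [m] least. In a tie the last clause forces a basis vector up to sign, which [kernel_null] relies
    on. *)
Definition good_step {R : realType} (x : R) (eta : nat -> R) (m : nat)
    (c s : R) :=
  [/\ eta m.+1 <= x <= eta m, forall l, (l < m)%N -> x < eta l.+1,
      c ^+ 2 + s ^+ 2 = 1, c ^+ 2 * eta m + s ^+ 2 * eta m.+1 = x
    & eta m = eta m.+1 -> s = 0].

(** The new entry is the trace of the two-by-two block minus the value [x] at the pivot vector. *)
Definition next_eta {R : realType} (x : R) (m : nat) (eta : nat -> R) :=
  collapse m (eta m + eta m.+1 - x) eta.

Lemma co_star_admissible {R : realType} {xi eta : nat -> R} :
  co_star xi -> co_star eta -> strongly_majorized xi eta -> admissible xi eta.
Proof.
move=> [xi0 xim _] [eta0 etam etac] [maj gap]; split=> //.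
- move=> e e0; have /cvgrPdist_lt/(_ e e0)[N _ HN] := etac.
  exists N => n Nn; have := HN n Nn.
  by rewrite /= sub0r normrN ger0_norm.
move=> e N e0; apply: contrapT => H.
have {}H n : (N <= n)%N -> e <= \sum_(j < n) (eta j - xi j).
  move=> Nn; rewrite leNgt; apply/negP => en; apply: H; by exists n.
have := limn_einf_lim (fun n => (\sum_(j < n) (eta j - xi j))%:E).
rewrite gap => /esym l0.
have : (e%:E <= 0)%E; last by rewrite lee_fin leNgt e0.
rewrite -l0; apply: lime_ge; first exact: is_cvg_einfs.
exists N => // n Nn; apply: le_ereal_inf_tmp => _ [p /= np <-].
by rewrite lee_fin H// (leq_trans Nn).
Qed.

Lemma good_step_exists {R : realType} {xi eta : nat -> R} :
  admissible xi eta -> exists m c s, good_step (xi 0) eta m c s.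
Proof.
move=> [xi0 xim eta0 etam etac maj gap].
have exm : exists m, eta m.+1 <= xi 0.
  have [x0|] := ltP 0 (xi 0).
    by have [N HN] := etac _ x0; exists N; rewrite ltW// HN.
  (* Here all of [xi] vanishes, so the gap over n >= 1 terms is at least [eta 0 >= eta 1]; if
     [eta 1] were positive, this would contradict strong majorization. *)
  move=> x0; exists 0; apply: contrapT => /negP; rewrite -ltNge => h.
  have e0 : 0 < eta 1 by rewrite (le_lt_trans _ h).
  have [n n0] := gap _ 1%N e0; apply/negP; rewrite -leNgt.
  apply: le_trans (etam _ _ (leq0n 1)) _.
  apply: (@le_trans _ _ (\sum_(j < n) eta j)).
    exact: ler_term_sum.
  apply: ler_sum => j _; rewrite lerBDr gerDl.
  exact: le_trans (xim _ _ (leq0n j)) x0.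
case: (ex_minnP exm) => m le_m min_m.
have ge_m : xi 0 <= eta m.
  case: m min_m {le_m} => [_|m min_m].
    by have := maj 1%N; rewrite !big_ord1.
  by rewrite leNgt; apply/negP => /ltW/min_m; rewrite ltnn.
have lt_m l : (l < m)%N -> xi 0 < eta l.+1.
  by rewrite ltNge; apply: contraL => /min_m; rewrite leqNgt.
have [em|ne] := eqVneq (eta m) (eta m.+1).
  exists m, 1, 0; split => //; first by rewrite le_m.
    by rewrite expr1n expr0n addr0.
  rewrite expr1n expr0n mul0r addr0 mul1r; apply/le_anti/andP; split=> //.
  by rewrite em.
have d0 : 0 < eta m - eta m.+1 by rewrite subr_gt0 lt_neqAle eq_sym ne etam.
(* The squares of [c] and [s] are the weights of [xi 0] as a convex combination of [eta m] and
   [eta m.+1]. *)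
exists m, (Num.sqrt ((xi 0 - eta m.+1) / (eta m - eta m.+1))).
exists (Num.sqrt ((eta m - xi 0) / (eta m - eta m.+1))).
have h1 : 0 <= (xi 0 - eta m.+1) / (eta m - eta m.+1).
  by rewrite divr_ge0 ?subr_ge0// etam.
have h2 : 0 <= (eta m - xi 0) / (eta m - eta m.+1).
  by rewrite divr_ge0 ?subr_ge0// etam.
split => //; first by rewrite le_m.
- by rewrite !sqr_sqrtr//; field; rewrite gt_eqF.
- by rewrite !sqr_sqrtr//; field; rewrite gt_eqF.
- by move=> e; rewrite e eqxx in ne.
Qed.

Lemma next_eta_admissible {R : realType} {xi eta : nat -> R} {m c s} :
  admissible xi eta -> good_step (xi 0) eta m c s ->
  admissible (fun n => xi n.+1) (next_eta (xi 0) m eta).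
Proof.
move=> [xi0 xim eta0 etam etac maj gap] [/andP[le_m ge_m] _ _ _ _].
have next_le l : next_eta (xi 0) m eta l <= eta l.
  rewrite /next_eta /collapse; case: (ltngtP l m) => [lm|lm|->] //.
    exact: etam.
  lra.
have sum_gt n : (m < n)%N -> \sum_(l < n) next_eta (xi 0) m eta l =
    \sum_(l < n.+1) eta l - xi 0.
  by move=> mn; rewrite sum_collapse//; ring.
split => //.
- by move=> i j ij; exact: xim.
- move=> l; rewrite /next_eta /collapse; case: (ltngtP l m) => // _.
  have := eta0 m.+1; lra.
- move=> i j; move: i j; apply/nonincreasing_seqP => l.
  rewrite /next_eta /collapse.
  case: (ltngtP l.+1 m) => [lm|lm|lm].
  + exact: etam.
  + case: (eqVneq l m) => [->|_]; last exact: etam.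
    have := etam _ _ (leqnSn m.+1); lra.
  + have := etam _ _ (leqnSn l); rewrite lm; lra.
- move=> e e0; have [N HN] := etac e e0; exists N => n Nn.
  exact: le_lt_trans (next_le _) (HN _ Nn).
(* Up to the pivot every entry of [eta] dominates [xi 0]; past it, this is the old majorization of
   [n.+1] terms with [xi 0] subtracted on both sides. *)
- move=> n; have [nm|mn] := leqP n m.
    rewrite sum_collapse_le//; apply: ler_sum => l _.
    apply: le_trans (xim _ _ (leq0n l.+1)) _; apply: le_trans ge_m _.
    by apply: etam; rewrite ltnW// (leq_trans (ltn_ord l)).
  rewrite sum_gt// lerBrDr addrC.
  by have := maj n.+1; rewrite big_ord_recl.
(* Past the pivot, the gap of n terms after the step equals the gap of n + 1 terms before it. *)
- move=> e N e0; have [n] := gap e (maxn N m.+1).+1 e0.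
  case: n => // n; rewrite ltnS geq_max => /andP[Nn mn] h.
  exists n => //; rewrite sumrB sum_gt//.
  by move: h; rewrite sumrB (big_ord_recl _ (fun l => xi l)) /=; lra.
Qed.

Lemma greedy_sequence {R : realType} {xi eta : nat -> R} : admissible xi eta ->
  exists (E : nat -> nat -> R) m c s, E 0 = eta /\ forall k,
    [/\ admissible (fun n => xi (k + n)%N) (E k),
        good_step (xi k) (E k) (m k) (c k) (s k)
      & E k.+1 = next_eta (xi k) (m k) (E k)].
Proof.
move=> adm0.
(* The choice is made for all pairs of a step number and a sequence, with zeros as default, so that
   the recursion can be defined before admissibility is proved. *)
have /choice[f fP] (p : nat * (nat -> R)) : exists q : nat * (R * R),
    admissible (fun n => xi (p.1 + n)%N) p.2 ->
    good_step (xi p.1) p.2 q.1 q.2.1 q.2.2.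
  have [adm|nadm] := pselect (admissible (fun n => xi (p.1 + n)%N) p.2).
    have [m [c [s]]] := good_step_exists adm; rewrite addn0 => good.
    by exists (m, (c, s)).
  by exists (0, (0, 0)).
pose E := fix E k := if k is k'.+1 then
  next_eta (xi k') (f (k', E k')).1 (E k') else eta.
exists E, (fun k => (f (k, E k)).1), (fun k => (f (k, E k)).2.1).
exists (fun k => (f (k, E k)).2.2); split=> // k.
have adm : admissible (fun n => xi (k + n)%N) (E k).
  elim: k => // k IH; have := fP (k, E k) IH; rewrite /= -{1}(addn0 k) => good.
  have := next_eta_admissible IH good; rewrite addn0.
  by under [X in admissible X _]eq_fun do rewrite addnS -addSn.
by split=> //; exact: (fP (k, E k)).
Qed.

(** * Diagonal entries along the greedy run *)

Section greedy.
Context {R : realType} {xi : nat -> R} {E : nat -> nat -> R}.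
Context {m : nat -> nat} {c s : nat -> R}.
Hypothesis admE : forall k, admissible (fun n => xi (k + n)%N) (E k).
Hypothesis goodE : forall k, good_step (xi k) (E k) (m k) (c k) (s k).
Hypothesis nextE : forall k, E k.+1 = next_eta (xi k) (m k) (E k).

Let cs1 k : c k ^+ 2 + s k ^+ 2 = 1.
Proof. by have [] := goodE k. Qed.

Let E_ge0 k l : 0 <= E k l.
Proof. exact: adm_eta_ge0 (admE k) l. Qed.

Lemma next_eta_pivot k :
  E k.+1 (m k) = s k ^+ 2 * E k (m k) + c k ^+ 2 * E k (m k).+1.
Proof.
have [_ _ h e _] := goodE k.
rewrite nextE /next_eta /collapse ltnn eqxx -{}e.
have -> : s k ^+ 2 = 1 - c k ^+ 2 by rewrite -h; ring.
ring.
Qed.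

(** Equality holds past the pivot; up to it, the extra entry [E k p] is at least
    [E k (m k) >= xi k]. *)
Lemma sum_next_le k p :
  \sum_(l < p) E k.+1 l <= \sum_(l < p.+1) E k l - xi k.
Proof.
have [/andP[_ ge_m] _ _ _ _] := goodE k.
rewrite nextE; have [pm|mp] := leqP p (m k).
  rewrite sum_collapse_le// big_ord_recr /= -addrA lerDl subr_ge0.
  exact: le_trans ge_m (adm_eta_mono (admE k) pm).
by rewrite sum_collapse// le_eqVlt; apply/orP; left; apply/eqP; ring.
Qed.

Lemma top_small {e} : 0 < e -> exists k, E k 0 < e.
Proof.
move=> e0; have e20 : 0 < e / 2 by rewrite divr_gt0.
have H r p : \sum_(l < p) E r l <= \sum_(l < p + r) E 0 l - \sum_(i < r) xi i.
  elim: r p => [|r IH] p; first by rewrite addn0 big_ord0 subr0.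
  apply: le_trans (sum_next_le _ _) _.
  have := IH p.+1; rewrite addSnnS (big_ord_recr r) /=; lra.
have [N HN] := adm_eta_small (admE 0) e20.
(* For p = 1 the bound in [H] is [E 0 r] plus the gap over r terms, each below [e / 2]. *)
have [r Nr] := adm_gap (admE 0) N e20.
rewrite sumrB => h; exists r; have := H r 1%N.
rewrite big_ord1 add1n (big_ord_recr r) /=; have := HN _ Nr.
move: h; rewrite /=; lra.
Qed.

(** [bwd] sends distinct basis vectors to vectors of disjoint support, so the quadratic form of
    [E k] pulls back to the diagonal form of [E k.+1]. The form of [E i] takes the value [xi i] at
    [pivot_vec i]. *)
Lemma row_eigenvalue i : exists N, forall n, (N <= n)%N ->
  \sum_(l < n) urow m c s i l ^+ 2 * E 0 l = xi i.
Proof.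
have H k b : exists N, forall n, (N <= n)%N ->
    \sum_(l < n + k) bwd_iter m c s k b l ^+ 2 * E 0 l =
    \sum_(l < n) b l ^+ 2 * E k l.
  elim: k b => [|k IH] b; first by exists 0 => n _; rewrite addn0.
  have [N HN] := IH (bwd m c s k b).
  exists (maxn N (m k).+1) => n; rewrite geq_max => /andP[Nn mn].
  rewrite addnS -addSn HN ?(leqW Nn)//=.
  pose v := b (m k) ^+ 2 * E k.+1 (m k).
  have -> : \sum_(l < n) b l ^+ 2 * E k.+1 l =
      \sum_(l < n) collapse (m k) v (fun l => bwd m c s k b l ^+ 2 * E k l) l.
    apply: eq_bigr => l _; rewrite /v [in LHS]nextE /next_eta /collapse /bwd.
    case: (ltngtP l (m k)) => [lm|lm|->] //.
      have -> : (l.+1 < m k)%N = false by lia.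
      have -> : (l.+1 == m k)%N = false by lia.
      by have -> : (l.+1 == (m k).+1)%N = false by lia.
    by rewrite nextE /next_eta /collapse ltnn eqxx.
  rewrite sum_collapse// /v next_eta_pivot /bwd !ltnn !eqxx.
  have -> : ((m k).+1 < m k)%N = false by lia.
  have -> : ((m k).+1 == m k)%N = false by lia.
  ring.
have [N HN] := H i (pivot_vec m c s i).
exists ((maxn N (m i).+2) + i)%N => n Nn.
have -> : n = (n - i + i)%N by lia.
rewrite HN; last by lia.
have : ((m i).+2 <= n - i)%N by lia.
have [_ _ _ exi _] := goodE i.
elim: (n - i)%N => // p IH; rewrite leq_eqVlt => /predU1P[<-|mp].
  rewrite !big_ord_recr /= big1 => [|l _]; rewrite /pivot_vec.
    rewrite !eqxx; have -> : ((m i).+1 == m i)%N = false by lia.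
    by rewrite add0r.
  have lm := ltn_ord l.
  have -> : (l == m i :> nat) = false by lia.
  have -> : (l == (m i).+1 :> nat) = false by lia.
  ring.
rewrite big_ord_recr /= IH// /pivot_vec.
have -> : (p == m i :> nat) = false by lia.
have -> : (p == (m i).+1 :> nat) = false by lia.
ring.
Qed.

(** * Completeness of the rows *)

Section kernel.
Context {x : nat -> R} {B : R}.
Hypothesis xB : sqsum_le x B.
Hypothesis Tx0 : forall i, rotate m c s x i = 0.
Let a k := residual m c s k x.

(** Orthogonality to f_k puts the plane part of [a k] along [(- s k, c k)], so collapsing the plane
    loses nothing of the quadratic form. *)
Lemma kernel_energy k : exists N, forall n, (N <= n)%N ->
  \sum_(l < n) E k l * a k l ^+ 2 = \sum_(l < n + k) E 0 l * x l ^+ 2.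
Proof.
have [|N HN] := @sum_telescope _ m (fun k l => E k l * a k l ^+ 2) (fun=> 0) k.
  move=> i n mn; rewrite addr0.
  pose v := E i.+1 (m i) * (a i (m i) ^+ 2 + a i (m i).+1 ^+ 2).
  have o : s i * a i (m i).+1 = - (c i * a i (m i)).
    by apply/eqP; rewrite -addr_eq0 addrC; apply/eqP; exact: Tx0.
  have -> : \sum_(l < n) E i.+1 l * a i.+1 l ^+ 2 =
      \sum_(l < n) collapse (m i) v (fun l => E i l * a i l ^+ 2) l.
    apply: eq_bigr => l _; rewrite /v {1}nextE /a /= /next_eta /fwd /collapse.
    case: (ltngtP l (m i)) => // _; rewrite -/(a i).
    rewrite nextE /next_eta /collapse ltnn eqxx; congr (_ * _).
    have -> : a i (m i) ^+ 2 + a i (m i).+1 ^+ 2 =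
       (c i ^+ 2 + s i ^+ 2) * (a i (m i) ^+ 2 + a i (m i).+1 ^+ 2)
       - (s i * a i (m i).+1 + c i * a i (m i)) ^+ 2.
      by rewrite cs1 o; ring.
    ring.
  rewrite sum_collapse// /v next_eta_pivot.
  set p := a i (m i); set q := a i (m i).+1.
  (* Both p and q are [- s i] and [c i] times a common factor, whose square is [p ^+ 2 + q ^+ 2]. *)
  have e1 : s i ^+ 2 * q ^+ 2 = c i ^+ 2 * p ^+ 2 by rewrite -!exprMn o sqrrN.
  have e2 : s i ^+ 2 * (p ^+ 2 + q ^+ 2) = p ^+ 2.
    by rewrite mulrDr e1 -mulrDl addrC cs1 mul1r.
  have e3 : c i ^+ 2 * (p ^+ 2 + q ^+ 2) = q ^+ 2.
    by rewrite mulrDr -e1 -mulrDl addrC cs1 mul1r.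
  have -> (u w : R) : (s i ^+ 2 * u + c i ^+ 2 * w) * (p ^+ 2 + q ^+ 2) =
      u * (s i ^+ 2 * (p ^+ 2 + q ^+ 2)) + w * (c i ^+ 2 * (p ^+ 2 + q ^+ 2)).
    ring.
  rewrite e2 e3; ring.
by exists N => n /HN; rewrite big1_eq addr0.
Qed.

Lemma kernel_energy_le0 M : \sum_(l < M) E 0 l * x l ^+ 2 <= 0.
Proof.
have B0 : 0 <= B by have := xB 0; rewrite big_ord0.
apply/ler_addgt0Pr => e e0; rewrite add0r.
have B10 : 0 < B + 1 by rewrite ltr_wpDl.
(* Dividing by B + 1 instead of B covers the case B = 0. *)
have [k hk] := top_small (divr_gt0 e0 B10).
have [N1 H1] := kernel_energy k.
have [N2 H2] := energy m c s cs1 x k.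
pose n := maxn M (maxn N1 N2).
have ge0 k' y i : 0 <= E k' i * y i ^+ 2 by rewrite mulr_ge0// sqr_ge0.
apply: (@le_trans _ _ (\sum_(l < n + k) E 0 l * x l ^+ 2)).
  apply: (@ler_sum_ord _ (fun l => E 0 l * x l ^+ 2)) => //; lia.
rewrite -H1; last by lia.
apply: (@le_trans _ _ (E k 0 * \sum_(l < n) a k l ^+ 2)).
  rewrite mulr_sumr; apply: ler_sum => l _; apply: ler_wpM2r.
    exact: sqr_ge0.
  exact: (adm_eta_mono (admE k) (leq0n l)).
have aB : \sum_(l < n) a k l ^+ 2 <= B.
  apply: le_trans _ (xB (n + k)); rewrite -H2; last by lia.
  by rewrite lerDl sumr_ge0// => i _; exact: sqr_ge0.
apply: (@le_trans _ _ (e / (B + 1) * B)).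
  by apply: ler_pM => //; [apply: sumr_ge0 => i _; exact: sqr_ge0|exact: ltW].
rewrite mulrAC ler_pdivrMr// ler_pM2l//; lra.
Qed.

(** By [kernel_energy] the form at stage k inherits nonpositive partial sums, while all its terms
    are nonnegative. *)
Lemma kernel_pos {k l} : 0 < E k l -> a k l = 0.
Proof.
move=> El; have [N HN] := kernel_energy k.
have h : E k l * a k l ^+ 2 <= 0.
  apply: le_trans _ (kernel_energy_le0 (maxn N l.+1 + k)).
  rewrite -HN ?leq_maxl//.
  apply: (@ler_term_sum _ (fun l => E k l * a k l ^+ 2)); last exact: leq_maxr.
  by move=> i; rewrite mulr_ge0// sqr_ge0.
apply/eqP; rewrite -sqrf_eq0 -[_ == 0]orFb -(gt_eqF El) -mulf_eq0.
by apply/eqP/le_anti; rewrite h mulr_ge0// ?sqr_ge0// ltW.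
Qed.

(* Strong induction on l: a null coordinate either moves to index l - 1 with a
   null eigenvalue, or lies in the rotated plane and is killed by f_k. *)
Lemma kernel_null {l k} : E k l = 0 -> a k l = 0.
Proof.
have [n] := ubnP l; elim: n l k => // n IH l k ln El.
have [_ lt_m _ _ s0] := goodE k.
have out0 : c k * a k (m k) + s k * a k (m k).+1 = 0 := Tx0 k.
have E0 j : (l <= j)%N -> E k j = 0.
  move=> lj; apply/le_anti; rewrite E_ge0 andbT -El.
  exact: (adm_eta_mono (admE k) lj).
have c_neq0 : s k = 0 -> c k != 0.
  move=> sk; apply/eqP => ck; have := cs1 k.
  by rewrite sk ck expr0n addr0 => /eqP; rewrite eq_sym oner_eq0.
have [lm|lm|lm] := ltngtP l (m k).
(* Below the pivot, minimality of [m k] would give [xi k < E k l.+1 = 0]. *)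
- have := lt_m _ lm; rewrite E0// ltNge.
  by have := adm_xi_ge0 (admE k) 0; rewrite addn0 => ->.
- case: l => // l in ln El E0 lm *; have [lm'|] := eqVneq l (m k).
    subst l; have [sk|sk] := eqVneq (s k) 0.
      have : a k.+1 (m k) = 0.
        apply: IH; first by lia.
        by rewrite next_eta_pivot sk El expr0n mul0r add0r mulr0.
      rewrite /a /= /fwd /collapse ltnn eqxx sk mul0r subr0 => /eqP.
      by rewrite mulf_eq0 (negPf (c_neq0 sk)) => /eqP.
    (* A zero entry here would be a tie and force [s k = 0]. Hence [kernel_pos] kills [a k (m k)],
       and orthogonality to f_k kills the other coordinate. *)
    have Em : 0 < E k (m k).
      rewrite lt_neqAle E_ge0 andbT; apply: contraNneq sk => Em.
      by apply/eqP/s0; rewrite -Em El.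
    move/eqP: out0; rewrite (kernel_pos Em) mulr0 add0r.
    by rewrite mulf_eq0 (negPf sk) => /eqP.
  move=> lm'; have {}lm : (m k < l)%N by lia.
  have fl (f : nat -> R) v : collapse (m k) v f l = f l.+1.
    by rewrite /collapse ltnNge (ltnW lm) (negPf lm').
  have := IH l k.+1; rewrite nextE /a /= /next_eta /fwd !fl.
  by apply => //; lia.
(* Both diagonal entries of the plane vanish, so the tie clause makes f_k a basis vector up to
   sign. *)
- have sk : s k = 0 by apply: s0; rewrite -lm !E0.
  move/eqP: out0; rewrite sk mul0r addr0 mulf_eq0 (negPf (c_neq0 sk)) -lm.
  by move/eqP.
Qed.


Lemma kernel0 l : x l = 0.
Proof.
have [E0|El] := eqVneq (E 0 l) 0; first exact: (kernel_null E0).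
by apply: (@kernel_pos 0); rewrite lt_neqAle eq_sym El E_ge0.
Qed.

End kernel.
End greedy.

(** * Passage to complex l^2 *)

Lemma cvg_complex {R : realType} (u v : nat -> R) (p q : R) :
  u @ \oo --> p -> v @ \oo --> q ->
  (fun n => u n +i* v n : R[i]^o) @ \oo --> (p +i* q : R[i]^o).
Proof.
move=> up vq; apply/cvgrPdist_lt => e e0.
have [r r0 re] : exists2 r : R, 0 < r & e = r%:C.
  move: e0; case: e => a b; rewrite ltcE /= => /andP[/eqP -> a0].
  by exists a.
have r20 : 0 < r / 2 by rewrite divr_gt0.
move/cvgrPdist_lt: up => /(_ _ r20) up; move/cvgrPdist_lt: vq => /(_ _ r20) vq.
near=> n.
have hu : `|p - u n| < r / 2 by near: n.
have hv : `|q - v n| < r / 2 by near: n.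
rewrite re normc_def ltcR /=.
apply: (@le_lt_trans _ _ (`|p - u n| + `|q - v n|)); last lra.
rewrite -(@ger0_norm _ (`|p - u n| + `|q - v n|)) ?addr_ge0// -sqrtr_sqr.
rewrite ler_wsqrtr// [leRHS]sqrrD !real_normK ?num_real//.
rewrite -addrA lerD2l lerDr mulrn_wge0// mulr_ge0//.
Unshelve. all: by end_near. Qed.

Lemma series_complex {R : realType} (f : nat -> R[i]) (p q : R) :
  series (fun n => complex.Re (f n)) @ \oo --> p ->
  series (fun n => complex.Im (f n)) @ \oo --> q ->
  limn (series (f : nat -> R[i]^o)) = p +i* q.
Proof.
move=> fp fq; apply/cvg_lim => //; move: (cvg_complex _ _ _ _ fp fq).
suff -> : series (f : nat -> R[i]^o) =
   (fun n => series (fun n => complex.Re (f n)) n +i*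
             series (fun n => complex.Im (f n)) n : R[i]^o) by [].
apply/funext => n; rewrite /series /=.
elim: n => [|n IH]; first by rewrite !big_nil.
by rewrite !big_nat_recr //= {}IH; case: (f n).
Qed.

Lemma ell2P {R : realType} (x : nat -> R[i]) : ell2 x <->
  exists B, sqsum_le (fun n => complex.Re (x n)) B /\
            sqsum_le (fun n => complex.Im (x n)) B.
Proof.
rewrite /ell2 /=; split=> [cx|[B [hr hi]]].
  exists (limn (series
    (fun n => complex.Re (x n) ^+ 2 + complex.Im (x n) ^+ 2))).
  have h n : \sum_(l < n) (complex.Re (x l) ^+ 2 + complex.Im (x l) ^+ 2) <=
      limn (series (fun n => complex.Re (x n) ^+ 2 + complex.Im (x n) ^+ 2)).
    suff /nondecreasing_cvgn_le/(_ cx n) : nondecreasing_seq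
      (series (fun n => complex.Re (x n) ^+ 2 + complex.Im (x n) ^+ 2)).
      by rewrite {1}seriesEord.
    move=> p q pq; rewrite seriesEord /=.
    apply: (@ler_sum_ord _
      (fun n => complex.Re (x n) ^+ 2 + complex.Im (x n) ^+ 2)).
      by move=> i; rewrite addr_ge0 ?sqr_ge0.
    exact: pq.
  by split=> n; apply: le_trans _ (h n); apply: ler_sum => l _;
    rewrite ?lerDl ?lerDr sqr_ge0.
apply: (@bounded_series_cvg _ _ (B + B)) => n.
  by rewrite addr_ge0 ?sqr_ge0.
by rewrite big_split /=; apply: lerD; [exact: hr|exact: hi].
Qed.

Lemma inner_complex {R : realType} (x y : nat -> R[i]) (rr ii ri ir : R) :
  series (fun n => complex.Re (x n) * complex.Re (y n)) @ \oo --> rr ->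
  series (fun n => complex.Im (x n) * complex.Im (y n)) @ \oo --> ii ->
  series (fun n => complex.Re (x n) * complex.Im (y n)) @ \oo --> ri ->
  series (fun n => complex.Im (x n) * complex.Re (y n)) @ \oo --> ir ->
  inner x y = (rr + ii) +i* (ir - ri).
Proof.
move=> h1 h2 h3 h4; apply: series_complex.
  have -> : (fun n => complex.Re (x n * (y n)^*)) = (fun n =>
     complex.Re (x n) * complex.Re (y n) + complex.Im (x n) * complex.Im (y n)).
    by apply/funext => n; case: (x n) (y n) => a b [c d] /=; ring.
  by rewrite [series _]seriesD; exact: cvgD.
have -> : (fun n => complex.Im (x n * (y n)^*)) = (fun n =>
   complex.Im (x n) * complex.Re (y n) - complex.Re (x n) * complex.Im (y n)).
  by apply/funext => n; case: (x n) (y n) => a b [c d] /=; ring.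
by rewrite [series _]seriesD [X in _ + X]seriesN; exact: cvgB.
Qed.

Lemma inner_basisr {R : realType} (x : nat -> R[i]) (i : nat) :
  inner x (std_basis R i) = x i.
Proof.
rewrite /inner; apply: (@cvg_lim R[i]^o) => //; apply: cvg_near_cst; near=> n.
rewrite /series /= big_mkord.
have ni : (i < n)%N by near: n; exact: nbhs_infty_gt.
rewrite (bigD1 (Ordinal ni))//= /std_basis eqxx /= conjC1 mulr1 big1 ?addr0//.
move=> l li; have -> : (l == i :> nat) = false.
  by apply: contraNF li => /eqP li; apply/eqP/val_inj.
by rewrite /= conjC0 mulr0.
Unshelve. all: by end_near. Qed.

Section complexify.
Context {R : realType} (m : nat -> nat) (c s : nat -> R).
Hypothesis cs1 : forall k, c k ^+ 2 + s k ^+ 2 = 1.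
Hypothesis rotate_ker0 : forall x B, sqsum_le x B ->
  (forall i, rotate m c s x i = 0) -> forall l, x l = 0.

(** A real matrix acts on real and imaginary parts separately. *)
Definition rotate_complex (x : nat -> R[i]) : nat -> R[i] := fun n =>
  rotate m c s (fun l => complex.Re (x l)) n +i*
  rotate m c s (fun l => complex.Im (x l)) n.

Lemma rotate_complex_unitary : unitary_op rotate_complex.
Proof.
split.
- move=> a x y _ _; apply/funext => n; rewrite /rotate_complex.
  case: a => p q.
  have -> : (fun l => complex.Re ((p +i* q) * x l + y l)) =
    (fun l => 1 * (p * complex.Re (x l) + (- q) * complex.Im (x l)) +
              1 * complex.Re (y l)).
    by apply/funext => l; case: (x l) (y l) => ? ? [? ?] /=; ring.
  have -> : (fun l => complex.Im ((p +i* q) * x l + y l)) =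
    (fun l => 1 * (p * complex.Im (x l) + q * complex.Re (x l)) +
              1 * complex.Im (y l)).
    by apply/funext => l; case: (x l) (y l) => ? ? [? ?] /=; ring.
  rewrite !rotate_linear; apply/eqP; rewrite eq_complex /=.
  by apply/andP; split; apply/eqP; ring.
- move=> x y /ell2P[B [xr xi]] /ell2P[C [yr yi]].
  have [rr [h1 k1]] := rotate_isometry m c s cs1 rotate_ker0 xr yr.
  have [ii [h2 k2]] := rotate_isometry m c s cs1 rotate_ker0 xi yi.
  have [ri [h3 k3]] := rotate_isometry m c s cs1 rotate_ker0 xr yi.
  have [ir [h4 k4]] := rotate_isometry m c s cs1 rotate_ker0 xi yr.
  rewrite (@inner_complex _ x y _ _ _ _ h1 h2 h3 h4).
  exact: (@inner_complex _ (rotate_complex x) (rotate_complex y)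
    _ _ _ _ k1 k2 k3 k4).
- apply/seteqP; split=> [_ [x /ell2P[B [xr xi]] <-]|y /ell2P[B [yr yi]]].
    by apply/ell2P; exists B; split; exact: rotate_sqsum_le.
  have [u uB Tu] := rotate_surjective m c s cs1 yr.
  have [v vB Tv] := rotate_surjective m c s cs1 yi.
  exists (fun l => u l +i* v l); first by apply/ell2P; exists B.
  by apply/funext => n; rewrite /rotate_complex /= Tu Tv; case: (y n).
Qed.

Lemma urow_orthogonal : orthogonal_matrix (urow m c s).
Proof.
exists rotate_complex; first exact: rotate_complex_unitary.
move=> i j; rewrite inner_basisr /rotate_complex.
have -> : (fun l => complex.Re (std_basis R j l)) = (fun l => (l == j)%:R).
  by apply/funext => l; rewrite /std_basis; case: eqP.
have -> : (fun l => complex.Im (std_basis R j l)) = (fun=> 0).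
  by apply/funext => l; rewrite /std_basis; case: eqP.
by rewrite rotate0 rotate_delta.
Qed.

End complexify.

Theorem theorem3p9 (R : realType) (xi eta : nat -> R)
    (hxi : co_star xi) (heta : co_star eta)
    (hmaj : strongly_majorized xi eta) :
  exists2 Q : nat -> nat -> R, orthostochastic Q & is_matrix_image Q eta xi.
Proof.
have [E [m [c [s [E0 HE]]]]] :=
  greedy_sequence (co_star_admissible hxi heta hmaj).
have admE k : admissible (fun n => xi (k + n)%N) (E k) by have [] := HE k.
have goodE k : good_step (xi k) (E k) (m k) (c k) (s k) by have [] := HE k.
have nextE k : E k.+1 = next_eta (xi k) (m k) (E k) by have [] := HE k.
have cs1 k : c k ^+ 2 + s k ^+ 2 = 1 by have [] := goodE k.
exists (fun i j => urow m c s i j ^+ 2).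
  exists (urow m c s) => //; apply: urow_orthogonal => // x B xB Tx0 l.
  exact: (kernel0 admE goodE nextE xB Tx0).
move=> i; have [N HN] := row_eigenvalue goodE nextE i.
(* Row i has finite support, so the series is eventually constant. *)
apply: cvg_near_cst; exists N => // n Nn.
by rewrite seriesEord /= -E0 HN.
Qed.
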